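(* For any positive integer $n$, the following identity holds (as an identity of rational functions in $q$): $$\sum_{k=0}^{n-1}\left(\frac{q}{4}\right)^k\sum_{j=0}^k\binom{2j}{j}\binom{2k-2j}{k-j}(6j+1)(6k-6j+1)=\frac{(9n^2-15n+8)q^{n+2}-(18n^2-12n-8)q^{n+1}+(9n^2+3n+2)q^n-2(2q+1)^2}{2(q-1)^3}.$$
   Context: Here $q$ is an indeterminate (equivalently, the identity holds for every complex number $q\neq 1$, with the convention $q^0=1$), and $\binom{a}{b}$ denotes the ordinary binomial coefficient. *)

(* Defs.v *)
From mathcomp Require Import all_boot all_algebra.
Set Implicit Arguments.
Unset Strict Implicit.
Unset Printing Implicit Defensive.
Import GRing.Theory.
Local Open Scope ring_scope.

(* Q(q): rational functions in one indeterminate q, the image of 'X. *)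
Definition ratfun : fieldType := {fraction {poly rat}}.

Definition q : ratfun := tofrac ('X : {poly rat}).

(* Main.v *)
Require Import Defs.
From mathcomp Require Import all_boot all_algebra.
From mathcomp Require Import ring zify.
Import GRing.Theory.
Local Open Scope ring_scope.

(** With [y = 4x], the generating function of [(6j+1) 'C(2j, j)] is
    [(1 + 2y) / (1 - y)^(3/2)], so its square, [(1 + 2y)^2 / (1 - y)^3], is
    rational and the inner sum is [4^k (9 k^2 + 3 k + 2) / 2]. The powers of 4
    then cancel and the outer sum is that of a quadratic polynomial against a
    geometric progression, which telescopes.

    The closed form of the inner sum is obtained here without power series.
    As [(6j+1)(6(k-j)+1) = 36 j (k-j) + 6k + 1], only the convolution of the
    central binomial coefficients with themselves, with weights [1] and
    [j (k-j)], is needed. The first-order recurrence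
    [(j+1) 'C(2j+2, j+1) = (4j+2) 'C(2j, j)] lets a weight [j] be traded for a
    shift of [k]; since the symmetry [j <-> k - j] evaluates the weight [j] as
    [k/2], this gives recurrences in [k] for both convolutions
    ([cbin_conv], [cbin_conv_weighted]). The integers are a convenient place for
    this, being a domain of characteristic 0; the result then maps to any
    commutative ring ([inner_sum]). The outer sum is
    [quadratic_geometric_sum], an induction on [n]. *)

Definition cbin (j : nat) : int := 'C(2 * j, j)%:R.

Lemma cbinS (j : nat) : j.+1%:R * cbin j.+1 = (4 * j%:R + 2) * cbin j.
Proof.
have H1 := mul_bin_diag (2 * j).+2 j.
have H2 := mul_bin_down (2 * j).+1 j.
have E : ((2 * j).+1 - j = j.+1)%N by lia.
rewrite E in H2; rewrite /= in H1 H2.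
rewrite /cbin (_ : (2 * j.+1 = (2 * j).+2)%N); last by lia.
have H : (j.+1 * 'C((2 * j).+2, j.+1) = (4 * j + 2) * 'C(2 * j, j))%N.
  rewrite -H1 (_ : ((2 * j).+2 = 2 * j.+1)%N); last by lia.
  by rewrite -mulnA -H2; lia.
by rewrite -natrM H natrM natrD natrM.
Qed.

Definition conv (w : nat -> int) (k : nat) : int :=
  \sum_(j < k.+1) w j * (cbin j * cbin (k - j)).

Lemma eq_conv w1 w2 k :
  (forall j, (j <= k)%N -> w1 j = w2 j) -> conv w1 k = conv w2 k.
Proof. by move=> eqw; apply: eq_bigr => j _; rewrite eqw ?leq_ord. Qed.

Lemma convD w1 w2 k : conv (fun j => w1 j + w2 j) k = conv w1 k + conv w2 k.
Proof. by rewrite /conv -big_split; apply: eq_bigr => j _; rewrite mulrDl. Qed.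

Lemma convZ c w k : conv (fun j => c * w j) k = c * conv w k.
Proof. by rewrite /conv mulr_sumr; apply: eq_bigr => j _; rewrite -mulrA. Qed.

Lemma conv_rev w k : conv w k = conv (fun j => w (k - j)%N) k.
Proof.
rewrite /conv (reindex_inj rev_ord_inj); apply: eq_bigr => j _ /=.
rewrite subSS subKn ?leq_ord //.
by rewrite [cbin (k - j) * _]mulrC.
Qed.

(** Trades a factor [j] in the weight for a shift of the index: the term
    [j = 0] vanishes and [cbinS] rewrites the others. *)
Lemma convS w k :
  conv (fun j => j%:R * w j) k.+1 = conv (fun j => (4 * j%:R + 2) * w j.+1) k.
Proof.
rewrite /conv big_ord_recl mul0r mul0r add0r; apply: eq_bigr => j _.
rewrite lift0 subSS.
transitivity (w j.+1 * (j.+1%:R * cbin j.+1) * cbin (k - j)); first by ring.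
by rewrite cbinS; ring.
Qed.

(** Averaging over the symmetry [j <-> k - j] replaces [j] by [k / 2]. *)
Lemma conv_linear k : 2 * conv (fun j => j%:R) k = k%:R * conv (fun=> 1) k.
Proof.
rewrite mulr_natl mulr2n {2}conv_rev -convD -convZ; apply: eq_conv => j le_jk.
by rewrite -natrD subnKC // mulr1.
Qed.

(** Writing [S k] for the convolution, [(k+1) S (k+1)] is twice the convolution
    weighted by [j]; shifting the index gives weight [4j + 2] and then, by
    symmetry again, [2 (2k + 2) S k]. *)
Lemma cbin_conv k : conv (fun=> 1) k = 4 ^+ k.
Proof.
elim: k => [|k IHk]; first by rewrite /conv big_ord1.
apply: (@mulfI _ k.+1%:R); first by rewrite Num.Theory.pnatr_eq0.
rewrite -conv_linear.
rewrite (@eq_conv _ (fun j => j%:R * 1)); last by move=> j _; rewrite mulr1.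
rewrite convS (@eq_conv _ (fun j => 4 * j%:R + 2 * 1)); last by move=> j _; ring.
rewrite convD !convZ exprS -IHk mulrDr mulrCA conv_linear -natr1; ring.
Qed.

(** Shifting through the factor [j] turns the weight [j (k+1-j)] into
    [4 j (k-j) + 2 (k-j)], whose second part is a multiple of [k * 4 ^+ k]. *)
Lemma cbin_conv_weighted k :
  8 * conv (fun j => j%:R * (k - j)%:R) k = k%:R * (k%:R - 1) * 4 ^+ k.
Proof.
elim: k => [|k IHk]; first by rewrite /conv big_ord1 !mul0r.
rewrite (convS (fun j => (k.+1 - j)%:R)).
rewrite (@eq_conv _ (fun j => 4 * (j%:R * (k - j)%:R) + 2 * (k - j)%:R)); last first.
  by move=> j _; rewrite subSS; ring.
rewrite convD !convZ -(conv_rev (fun j => j%:R)) conv_linear cbin_conv.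
rewrite mulrDr mulrCA IHk exprS -natr1; ring.
Qed.

(** The factor 2 keeps the identity integral, hence valid in every commutative
    ring. *)
Lemma inner_sum (R : comNzRingType) (k : nat) :
  2 * (\sum_(0 <= j < k.+1)
        'C(2 * j, j)%:R * 'C(2 * k - 2 * j, k - j)%:R *
        (6 * j%:R + 1) * (6 * k%:R - 6 * j%:R + 1))
  = 4 ^+ k * (9 * k%:R ^+ 2 + 3 * k%:R + 2) :> R.
Proof.
have intE : 2 * conv (fun j => 36 * (j%:R * (k - j)%:R) + (6 * k%:R + 1) * 1) k
            = 4 ^+ k * (9 * k%:R ^+ 2 + 3 * k%:R + 2).
  (* The extra factor 4 makes up the 8 in [cbin_conv_weighted]. *)
  apply: (@mulfI _ 4) => //.
  rewrite convD !convZ cbin_conv.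
  transitivity (36 * (8 * conv (fun j => j%:R * (k - j)%:R) k)
                + 8 * (6 * k%:R + 1) * 4 ^+ k); first by ring.
  by rewrite cbin_conv_weighted; ring.
have := congr1 (fun z : int => z%:~R : R) intE.
rewrite !(rmorphM, rmorphD, rmorphXn, rmorph_nat) /= => <-.
congr (_ * _); rewrite rmorph_sum big_mkord; apply: eq_bigr => j _ /=.
have le_jk : (j <= k)%N := leq_ord j.
rewrite /cbin !(rmorphM, rmorphD, rmorph_nat, rmorph1) /= mulnBr natrB //.
ring.
Qed.

Lemma quadratic_geometric_sum (F : fieldType) (x : F) (n : nat) :
  2 != 0 :> F -> x != 1 ->
  \sum_(0 <= k < n) x ^+ k * ((9 * k%:R ^+ 2 + 3 * k%:R + 2) / 2)
  = ((9 * n%:R ^+ 2 - 15 * n%:R + 8) * x ^+ (n + 2)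
      - (18 * n%:R ^+ 2 - 12 * n%:R - 8) * x ^+ (n + 1)
      + (9 * n%:R ^+ 2 + 3 * n%:R + 2) * x ^+ n
      - 2 * (2 * x + 1) ^+ 2)
    / (2 * (x - 1) ^+ 3).
Proof.
move=> nz2 x1; have nzx : x - 1 != 0 by rewrite subr_eq0.
elim: n => [|n IHn].
  rewrite big_geq // [X in X / _](_ : _ = 0) ?mul0r //.
  rewrite /=; ring.
rewrite big_nat_recr //= IHn !exprD !exprS -natr1 expr0.
by field; apply/andP.
Qed.

Lemma scaled_term (F : fieldType) (x : F) (k : nat) :
  2 != 0 :> F ->
  (x / 4) ^+ k *
     (\sum_(0 <= j < k.+1)
        'C(2 * j, j)%:R * 'C(2 * k - 2 * j, k - j)%:R *
        (6 * j%:R + 1) * (6 * k%:R - 6 * j%:R + 1))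
  = x ^+ k * ((9 * k%:R ^+ 2 + 3 * k%:R + 2) / 2).
Proof.
move=> nz2; have nz4 : 4 != 0 :> F by rewrite (natrM _ 2 2) mulf_neq0.
apply: (mulfI nz2); rewrite mulrCA inner_sum expr_div_n mulrA.
by rewrite divfK ?expf_neq0 // [RHS]mulrCA [2 * (_ / _)]mulrC divfK.
Qed.

Lemma ratfun_two_neq0 : 2 != 0 :> ratfun.
Proof.
rewrite -(rmorph_nat (@tofrac {poly rat})) tofrac_eq0.
by rewrite -polyC_natr polyC_eq0 Num.Theory.pnatr_eq0.
Qed.

Lemma q_neq1 : q != 1.
Proof.
rewrite /q -tofrac1 tofrac_eq; apply/eqP => /(congr1 (fun p : {poly rat} => size p)).
by rewrite size_polyX size_poly1.
Qed.

Theorem theorem1p2 (n : nat) (n_gt0 : (0 < n)%N) :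
  \sum_(0 <= k < n) (q / 4) ^+ k *
     (\sum_(0 <= j < k.+1)
        'C(2 * j, j)%:R * 'C(2 * k - 2 * j, k - j)%:R *
        (6 * j%:R + 1) * (6 * k%:R - 6 * j%:R + 1))
  = ((9 * n%:R ^+ 2 - 15 * n%:R + 8) * q ^+ (n + 2)
      - (18 * n%:R ^+ 2 - 12 * n%:R - 8) * q ^+ (n + 1)
      + (9 * n%:R ^+ 2 + 3 * n%:R + 2) * q ^+ n
      - 2 * (2 * q + 1) ^+ 2)
    / (2 * (q - 1) ^+ 3)
  :> ratfun.
Proof.
rewrite -(quadratic_geometric_sum _ _ n ratfun_two_neq0 q_neq1).
by apply: eq_bigr => k _; apply: scaled_term ratfun_two_neq0.
Qed.
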